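(* Suppose Assumptions (A1)–(A3) hold and $\bar g$ is a $c$-contraction towards $\theta^*\in\mathcal C$ for some $c>0$. Choose step sizes with $\eta_1\in[1/c,2/c]$ and $\eta_{t+1}=\exp(-\tfrac12c\eta_t)\eta_t$ for $t\ge1$, and let $\theta_{t+1}=\mathbf P_{\mathcal C}(\theta_t-\eta_t\hat g_t(\theta_t,z_t))$ with $\theta_0\in\mathcal C$. Then there is a constant $K$, independent of $T$ and $\tau$ (depending polynomially on $C_0,C_1,G$ and on $c$), such that for all $T\ge2$ $$\mathbb E\|\theta_T-\theta^*\|^2\le K\Big(\frac{\tau^2(\log T)^3}{T}+\frac1T\sum_{t=1}^T\mathbb E e_t^2\Big).$$ In particular, if $\tau=O(1)$ and $\mathbb E e_t^2=O(1/t)$, then $\mathbb E\|\theta_T-\theta^*\|^2=O((\log T)^3/T)$.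
   Context: $(z_t)_{t\ge0}$ is a random data sequence in a space $\mathcal Z$, $\mathcal C\subset\mathbb R^d$ is closed convex, $\mathbf P_{\mathcal C}$ is the Euclidean projection onto $\mathcal C$, and $\hat g_t(\theta,z)\in\mathbb R^d$ are (possibly random, data-dependent) update directions. (A1) $z_t$ is an ergodic Markov chain on $\mathcal Z$ with stationary distribution $\mu$ and finite mixing time $\tau$, i.e. $\|P(z_\tau\in\cdot\,|z_0)-\mu\|_{TV}\le1/4$ for every $z_0$. (A2) There is a function $g(\theta,z)$ with $\bar g(\theta):=\int g(\theta,z)\,\mu(dz)$, and random variables $e_t$ with $\mathbb E e_t^2<\infty$ such that $\|g(\theta_t,z_t)-\hat g_t(\theta_t,z_t)\|\le e_t$. (A3) $\theta^*\in\mathcal C$; there are $C_0,C_1>0$ with $\|\bar g\|_\infty,\|\hat g_t\|_\infty,\|g\|_\infty\le C_0$ and $\mathcal C\subset\{\theta:\|\theta\|\le C_1\}$; there is $G>0$ such that $\theta\mapsto g(\theta,z)$ is $G$-Lipschitz on $\mathcal C$ for every $z$. A vector field $\bar g$ is a $c$-contraction towards $\theta^*$ if $\bar g(\theta^* )=0$ and $\langle\theta-\theta^*,\bar g(\theta)\rangle\ge c\|\theta-\theta^*\|^2$ for all $\theta$.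
   Formalization: The iterates θ_t are assumed adapted to a filtration for which z_t is Markov (the updates do not use future data), without which the claim fails; τ≥1 is assumed, and the immediate ''in particular'' rate is not stated separately. *)

(* Defs.v *)
From HB Require Import structures.
From mathcomp Require Import all_boot all_order all_algebra.
From mathcomp Require Import all_classical all_reals all_analysis.
From mathcomp Require Import measurable_realfun.
Set Implicit Arguments. Unset Strict Implicit. Unset Printing Implicit Defensive.
Import Order.TTheory GRing.Theory Num.Theory.
Import numFieldNormedType.Exports.
Local Open Scope classical_set_scope.
Local Open Scope ring_scope.

Definition edot {R : realType} {d : nat} (u v : 'rV[R]_d) : R :=
  \sum_(i < d) u ord0 i * v ord0 i.
Definition enorm {R : realType} {d : nat} (u : 'rV[R]_d) : R :=
  Num.sqrt (edot u u).

Definition is_convex_set {R : realType} {d : nat} (C : set 'rV[R]_d) : Prop :=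
  forall x y (l : R), C x -> C y -> 0 <= l -> l <= 1 ->
    C (l *: x + (1 - l) *: y).

Definition is_proj {R : realType} {d : nat} (C : set 'rV[R]_d)
  (x p : 'rV[R]_d) : Prop :=
  C p /\ forall q, C q -> enorm (x - p) <= enorm (x - q).

Definition gbar {R : realType} {dZ : measure_display} {Z : measurableType dZ}
  {d : nat} (mu : probability Z R) (g : 'rV[R]_d -> Z -> 'rV[R]_d)
  (theta : 'rV[R]_d) : 'rV[R]_d :=
  \row_(i < d) fine (\int[mu]_z ((g theta z) ord0 i)%:E)%E.

(* c-is_contraction_to towards theta* (on the domain C where the iterates live). *)
Definition is_contraction_to {R : realType} {d : nat} (C : set 'rV[R]_d)
  (gb : 'rV[R]_d -> 'rV[R]_d) (c : R) (ths : 'rV[R]_d) : Prop :=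
  gb ths = 0 /\
  forall theta, C theta ->
    c * enorm (theta - ths) ^+ 2 <= edot (theta - ths) (gb theta).

Fixpoint kpow {R : realType} {dZ : measure_display} {Z : measurableType dZ}
  (Pk : Z -> probability Z R) (n : nat) (z : Z) (B : set Z) : \bar R :=
  match n with
  | 0%N => (\1_B z)%:E
  | n'.+1 => (\int[Pk z]_y kpow Pk n' y B)%E
  end.

Definition markov_wrt {R : realType} {dO : measure_display}
  {Omega : measurableType dO} {dZ : measure_display} {Z : measurableType dZ}
  (P : probability Omega R) (F : nat -> set (set Omega))
  (Pk : Z -> probability Z R) (z : nat -> Omega -> Z) : Prop :=
  (forall t, sigma_algebra setT (F t)) /\
  (forall t A, F t A -> measurable A) /\
  (forall t A, F t A -> F t.+1 A) /\
  (forall B, measurable B -> measurable_fun setT (fun x => Pk x B)) /\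
  (forall t B, measurable B -> F t (z t @^-1` B)) /\
  (forall t A B, F t A -> measurable B ->
     P (A `&` z t.+1 @^-1` B) = (\int[P]_(w in A) Pk (z t w) B)%E).

Definition stationary {R : realType} {dZ : measure_display}
  {Z : measurableType dZ} (Pk : Z -> probability Z R)
  (mu : probability Z R) : Prop :=
  forall B, measurable B -> mu B = (\int[mu]_y Pk y B)%E.

(* finite mixing time tau: ||P^tau(z0, .) - mu||_TV <= 1/4 for every z0,
   with ||P - Q||_TV = sup_B |P(B) - Q(B)|. *)
Definition mixing_time {R : realType} {dZ : measure_display}
  {Z : measurableType dZ} (Pk : Z -> probability Z R)
  (mu : probability Z R) (tau : nat) : Prop :=
  forall z0 B, measurable B -> (`| kpow Pk tau z0 B - mu B | <= (4^-1)%:E)%E.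

Definition vmeas_wrt {R : realType} {dO : measure_display}
  {Omega : measurableType dO} {d : nat} (G : set (set Omega))
  (X : Omega -> 'rV[R]_d) : Prop :=
  forall (i : 'I_d) (B : set R), measurable B ->
    G ((fun w => X w ord0 i) @^-1` B).

(* Main.v *)
Require Import Defs.
From HB Require Import structures.
From mathcomp Require Import all_boot all_order all_algebra.
From mathcomp Require Import all_classical all_reals all_analysis.
From mathcomp Require Import measurable_realfun.
From mathcomp Require Import zify ring lra.
Import Order.TTheory GRing.Theory Num.Theory.
Import numFieldNormedType.Exports.
Local Open Scope classical_set_scope.
Local Open Scope ring_scope.

(** With [u_t = E |theta_t - theta*|^2 / eta_t], the identity
    [eta_(t+1) / eta_t = exp (- c eta_t / 2)] turns the contraction into
    [u_(t+1) <= u_t + 4 (2 b_t + E e_t^2 / c + eta_t C0^2)], where [b_t] bounds the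
    expectation of [H(theta_t, z_t)], the inner product of [theta_t - theta*] with
    [gbar(theta_t) - g(theta_t, z_t)].  Since [eta_t <= 2 / (c t)], summing gives the rate
    once the [b_t] are controlled.  With [m = tau * ceil(log2 T)], for [t > m] the
    Lipschitz field [H] allows to replace [theta_t] by [theta_(t-m)] at cost [O(m / t)],
    and conditionally on the past at time [t - m] the chain is within [2^(- m / tau)] of
    stationarity, where [H(theta, .)] has mean zero.  The kernel operator is handled on
    bounded functions: [tau] steps halve the width of an interval containing the range. *)

(** * Euclidean geometry and projections *)

Section Euclid.
Context {R : realType} {d : nat}.
Implicit Types (u v w : 'rV[R]_d) (C : set 'rV[R]_d).

Lemma edotC u v : edot u v = edot v u.
Proof. by apply: eq_bigr => i _; rewrite mulrC. Qed.

Lemma edotDl u v w : edot (u + v) w = edot u w + edot v w.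
Proof. by rewrite -big_split; apply: eq_bigr => i _; rewrite mxE mulrDl. Qed.

Lemma edotZl a u v : edot (a *: u) v = a * edot u v.
Proof. by rewrite mulr_sumr; apply: eq_bigr => i _; rewrite mxE mulrA. Qed.

Lemma edotNl u v : edot (- u) v = - edot u v.
Proof. by rewrite -scaleN1r edotZl mulN1r. Qed.

Lemma edotBl u v w : edot (u - v) w = edot u w - edot v w.
Proof. by rewrite edotDl edotNl. Qed.

Lemma edotDr u v w : edot w (u + v) = edot w u + edot w v.
Proof. by rewrite edotC edotDl !(edotC w). Qed.

Lemma edotBr u v w : edot w (u - v) = edot w u - edot w v.
Proof. by rewrite edotC edotBl !(edotC w). Qed.

Lemma edotZr a u v : edot u (a *: v) = a * edot u v.
Proof. by rewrite edotC edotZl edotC. Qed.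

Lemma edot_ge0 u : 0 <= edot u u.
Proof. by apply: sumr_ge0 => i _; rewrite -expr2 sqr_ge0. Qed.

Lemma enorm_ge0 u : 0 <= enorm u.
Proof. exact: sqrtr_ge0. Qed.

Lemma enorm_sqr u : enorm u ^+ 2 = edot u u.
Proof. by rewrite sqr_sqrtr ?edot_ge0. Qed.

Lemma enorm0_eq0 u : enorm u = 0 -> u = 0.
Proof.
move=> u0; have : edot u u = 0 by rewrite -enorm_sqr u0 expr0n.
move=> /psumr_eq0P u20; apply/rowP => i; rewrite mxE.
have /eqP := u20 (fun j _ => sqr_ge0 (u ord0 j)) i isT.
by rewrite mulf_eq0 orbb => /eqP.
Qed.

Lemma enormN u : enorm (- u) = enorm u.
Proof. by rewrite /enorm edotNl edotC edotNl opprK. Qed.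

Lemma enormB u v : enorm (u - v) = enorm (v - u).
Proof. by rewrite -enormN opprB. Qed.

Lemma enormZ a u : 0 <= a -> enorm (a *: u) = a * enorm u.
Proof.
move=> a0; rewrite /enorm edotZl edotZr mulrA -expr2.
by rewrite sqrtrM ?sqr_ge0// sqrtr_sqr ger0_norm.
Qed.

(** Cauchy-Schwarz: expand the square of [enorm v *: u - enorm u *: v] and divide by the product of
    the norms, zero vectors being treated apart. *)
Lemma edot_le u v : edot u v <= enorm u * enorm v.
Proof.
have [/enorm0_eq0 ->|u0] := eqVneq (enorm u) 0.
  by rewrite -(scale0r 0) edotZl mul0r mulr_ge0 ?enorm_ge0.
have [/enorm0_eq0 ->|v0] := eqVneq (enorm v) 0.
  by rewrite -(scale0r 0) edotZr mul0r mulr_ge0 ?enorm_ge0.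
have p : 0 < enorm u * enorm v by rewrite mulr_gt0// lt_def enorm_ge0 ?u0 ?v0.
have := edot_ge0 (enorm v *: u - enorm u *: v).
rewrite !(edotBl, edotBr, edotZl, edotZr) -!enorm_sqr (edotC v u) => h.
by rewrite -subr_ge0 -(pmulr_rge0 _ p); lra.
Qed.

Lemma enorm_sqrD u v :
  enorm (u + v) ^+ 2 = enorm u ^+ 2 + 2 * edot u v + enorm v ^+ 2.
Proof. by rewrite !enorm_sqr edotDl !edotDr (edotC v u); ring. Qed.

Lemma enorm_sqrB u v :
  enorm (u - v) ^+ 2 = enorm u ^+ 2 - 2 * edot u v + enorm v ^+ 2.
Proof. by rewrite enorm_sqrD enormN (edotC u) edotNl (edotC v); ring. Qed.

Lemma enormD u v : enorm (u + v) <= enorm u + enorm v.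
Proof.
rewrite -(@ler_pXn2r _ 2) ?nnegrE ?addr_ge0 ?enorm_ge0//.
by rewrite enorm_sqrD; have := edot_le u v; lra.
Qed.

(** The angle at [p] between [x] and a point of [C] is never acute; expanding the square of
    [(x - p) - (q - p)] then gives the bound. *)
Lemma proj_nonexp {C x p q} : is_convex_set C -> is_proj C x p -> C q ->
  enorm (p - q) <= enorm (x - q).
Proof.
move=> cC [Cp minp] Cq.
suff h : edot (x - p) (q - p) <= 0.
  rewrite -(@ler_pXn2r _ 2) ?nnegrE ?enorm_ge0//.
  have -> : x - q = (x - p) - (q - p) by rewrite opprB addrA subrK.
  rewrite (enorm_sqrB (x - p)) (enormB p q).
  by have := sqr_ge0 (enorm (x - p)); lra.
rewrite leNgt; apply/negP => s0; set s := edot _ _ in s0.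
set n2 := enorm (q - p) ^+ 2.
have n0 : 0 <= n2 by rewrite sqr_ge0.
(* If [s] were positive, moving from [p] to [q] by the fraction [l] would come closer to [x]:
   minimality forces [2 * s <= l * n2], whereas [l * n2 < s] for this [l]. *)
pose l := s / (s + n2).
have sn0 : 0 < s + n2 by lra.
have l0 : 0 < l by rewrite divr_gt0.
have l1 : l <= 1 by rewrite ler_pdivrMr// mul1r; lra.
have := minp _ (cC _ _ _ Cq Cp (ltW l0) l1).
have -> : x - (l *: q + (1 - l) *: p) = (x - p) - l *: (q - p).
  by apply/rowP => i; rewrite !mxE; ring.
rewrite -(@ler_pXn2r _ 2) ?nnegrE ?enorm_ge0// (enorm_sqrB (x - p)) edotZr -/s.
rewrite (enormZ _ _ (ltW l0)) exprMn -/n2 => h.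
have : 2 * s <= l * n2 by rewrite -(ler_pM2l l0); lra.
rewrite /l mulrAC ler_pdivlMr// => h2.
have := mulr_gt0 s0 s0; have := mulr_ge0 (ltW s0) n0; lra.
Qed.

End Euclid.

(** * Positive linear functionals on bounded measurable functions *)

Section BoundedMeasurable.
Context {R : realType} {dT : measure_display} {T : measurableType dT}.
Implicit Types (f g : T -> R) (I J : (T -> R) -> R) (B : set T).

Definition bmeas f :=
  measurable_fun setT f /\ exists M, forall x, `|f x| <= M.

Lemma bmeas_cst (a : R) : bmeas (cst a).
Proof. by split; [exact: measurable_cst | exists `|a|]. Qed.

Lemma bmeas_indic B : measurable B -> bmeas (\1_B).
Proof.
split; first exact: measurable_indic.
by exists 1 => x; rewrite indicE normr_nat lern1 leq_b1.
Qed.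

Lemma bmeasD f g : bmeas f -> bmeas g -> bmeas (f \+ g).
Proof.
move=> [mf [M fM]] [mg [N gN]]; split; first exact: measurable_funD.
by exists (M + N) => x; rewrite (le_trans (ler_normD _ _))// lerD.
Qed.

Lemma bmeasZ (a : R) f : bmeas f -> bmeas (fun x => a * f x).
Proof.
move=> [mf [M fM]]; split; first exact: measurable_funM.
by exists (`|a| * M) => x; rewrite normrM ler_wpM2l.
Qed.

Lemma bmeas_sum (K : Type) (s : seq K) (h : K -> T -> R) :
  (forall k, bmeas (h k)) -> bmeas (fun x => \sum_(k <- s) h k x).
Proof.
move=> mh; elim: s => [|k s IHs].
  by under eq_fun do rewrite big_nil; exact: bmeas_cst.
by under eq_fun do rewrite big_cons; exact: (bmeasD _ _ (mh k) IHs).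
Qed.

Lemma bmeas_itv {f} a b : measurable_fun setT f ->
  (forall x, a <= f x <= b) -> bmeas f.
Proof.
move=> mf fab; split=> //; exists (`|a| + `|b|) => x.
have /andP[fa fb] := fab x.
rewrite ler_norml; apply/andP; split.
  by have := ler_norm (- a); rewrite normrN; have := normr_ge0 b; lra.
by have := ler_norm b; have := normr_ge0 a; lra.
Qed.

(** A common frame for integrals over events, laws of the chain and iterates of the kernel operator,
    so that comparisons on indicators pass to functions once and for all. *)
Definition plin I := [/\ forall f g, bmeas f -> bmeas g -> I (f \+ g) = I f + I g,
  forall a f, bmeas f -> I (fun x => a * f x) = a * I f
  & forall f g, bmeas f -> bmeas g -> (forall x, f x <= g x) -> I f <= I g].

Section PositiveLinear.
Context {I : (T -> R) -> R} (linI : plin I).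

Lemma plinD f g : bmeas f -> bmeas g -> I (f \+ g) = I f + I g.
Proof. by case: linI => + _ _; apply. Qed.

Lemma plinZ a f : bmeas f -> I (fun x => a * f x) = a * I f.
Proof. by case: linI => _ + _; apply. Qed.

Lemma le_plin f g : bmeas f -> bmeas g -> (forall x, f x <= g x) -> I f <= I g.
Proof. by case: linI => _ _; apply. Qed.

Lemma plin_cst a : I (cst a) = a * I (cst 1).
Proof.
rewrite -plinZ; last exact: bmeas_cst.
by congr I; apply/funext => x /=; rewrite mulr1.
Qed.

Lemma plin_sum (K : Type) (s : seq K) (h : K -> T -> R) :
  (forall k, bmeas (h k)) ->
  I (fun x => \sum_(k <- s) h k x) = \sum_(k <- s) I (h k).
Proof.
move=> mh; elim: s => [|k s IHs].
  under eq_fun do rewrite big_nil.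
  by rewrite big_nil [LHS](plin_cst 0) mul0r.
under eq_fun do rewrite big_cons.
by rewrite big_cons [LHS]plinD ?IHs//; exact: bmeas_sum.
Qed.

End PositiveLinear.

(** When [f] lies in [0, 1] this is the integer part of [n * f], split into [n] indicators of
    superlevel sets to which set-wise bounds apply. *)
Definition layers n f (x : T) : R :=
  \sum_(k < n) \1_[set y | k.+1%:R <= n%:R * f y] x.

Lemma sum_ltn_minn m n : (\sum_(k < n) (k < m) = minn m n)%N.
Proof.
elim: n => [|n IHn]; first by rewrite big_ord0 minn0.
by rewrite big_ord_recr /= IHn; lia.
Qed.

Lemma layersP n f x : 0 <= f x <= 1 ->
  layers n f x <= n%:R * f x <= layers n f x + 1.
Proof.
move=> /andP[f0 f1].
have nf0 : 0 <= n%:R * f x by rewrite mulr_ge0.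
have -> : layers n f x = (Num.truncn (n%:R * f x))%:R.
  have le_n : (Num.truncn (n%:R * f x) <= n)%N.
    rewrite -(@ler_nat R) (@le_trans _ _ (n%:R * f x)) ?truncn_le//.
    by rewrite -[leRHS]mulr1 ler_wpM2l.
  (* The level [k.+1] is reached exactly when [k] is below the truncation, so the sum counts such
     [k]. *)
  rewrite /layers -[in RHS](minn_idPl le_n) -sum_ltn_minn natr_sum.
  by apply: eq_bigr => k _; rewrite truncn_gt_nat indicE mem_setE.
have /andP[h1 h2] := truncn_itv nf0.
by rewrite h1 natr1 ltW.
Qed.

Lemma bmeas_layers n f : measurable_fun setT f ->
  (forall k : 'I_n, measurable [set y | k.+1%:R <= n%:R * f y]).
Proof.
move=> mf k; have mnf : measurable_fun setT (fun y => n%:R * f y).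
  exact: measurable_funM.
have := mnf measurableT `[k.+1%:R, +oo[%classic (measurable_itv _).
rewrite setTI; congr measurable; apply/seteqP; split => y /=.
  by rewrite in_itv /= andbT.
by rewrite in_itv /= andbT.
Qed.

(** Rounding [n * f] to its layers costs the mass of [I] once, and each of the [n] layers costs
    [eps]; division by [n] leaves [eps] and an arbitrarily small error. *)
Lemma plin_le_indic {I J eps f} : plin I -> plin J -> 0 <= eps ->
  (forall B, measurable B -> I \1_B <= J \1_B + eps) ->
  measurable_fun setT f -> (forall x, 0 <= f x <= 1) ->
  I f <= J f + eps.
Proof.
move=> linI linJ eps0 IJ mf f01; apply/ler_addgt0Pr => d d0.
have I1 : 0 <= I (cst 1).
  rewrite -(mul0r (I (cst 1))) -plin_cst//.
  by apply: le_plin => //; exact: bmeas_cst.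
(* With this [n] the rounding error [I (cst 1) / n] is at most [d]. *)
pose n := (Num.truncn (I (cst 1) / d)).+1.
have n0 : 0 < n%:R :> R by [].
have In : I (cst 1) <= n%:R * d by rewrite -ler_pdivrMr// ltW// truncnS_gt.
rewrite -(ler_pM2l n0) !mulrDr -!plinZ//; do 2?exact: bmeas_itv mf f01.
have bl k := bmeas_indic _ (bmeas_layers n _ mf k).
have bnf : bmeas (fun x => n%:R * f x) by exact/bmeasZ/(bmeas_itv _ _ mf f01).
have blay : bmeas (layers n f) by exact: bmeas_sum.
have h1 : I (fun x => n%:R * f x) <= I (layers n f \+ cst 1).
  apply: le_plin => //; first exact/bmeasD/bmeas_cst.
  by move=> x; have /andP[] := layersP n f x (f01 x).
have h2 : J (layers n f) <= J (fun x => n%:R * f x).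
  by apply: le_plin => // x; have /andP[] := layersP n f x (f01 x).
have h3 : I (layers n f) <= J (layers n f) + n%:R * eps.
  rewrite /layers !plin_sum//.
  rewrite mulr_natl -[X in eps *+ X]card_ord -sumr_const -big_split /=.
  by apply: ler_sum => k _; apply/IJ/bmeas_layers.
rewrite plinD// in h1; last exact: bmeas_cst.
by lra.
Qed.

(* Extends total variation bounds from sets to functions, by layer-cake decomposition. *)
Lemma plin_le_osc {I J eps f a b} : plin I -> plin J -> 0 <= eps ->
  I (cst 1) = J (cst 1) ->
  (forall B, measurable B -> I \1_B <= J \1_B + eps) ->
  measurable_fun setT f -> (forall x, a <= f x <= b) -> a < b ->
  I f <= J f + eps * (b - a).
Proof.
move=> linI linJ eps0 IJ1 IJ mf fab ab.
(* Rescaling to [0, 1]; since the masses of [I] and [J] agree, the shift by [a] contributes equally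
   to both sides. *)
pose h x := (b - a)^-1 * (f x - a).
have ba0 : 0 < b - a by rewrite subr_gt0.
have mfa : measurable_fun setT (fun x => f x - a) by exact: measurable_funB.
have mh : measurable_fun setT h by exact: measurable_funM.
have h01 x : 0 <= h x <= 1.
  have /andP[? ?] := fab x.
  rewrite /h mulr_ge0 ?invr_ge0 ?(ltW ba0) ?subr_ge0//=.
  by rewrite ler_pdivrMl// mulr1 lerB.
have bh : bmeas h by exact: bmeas_itv mh h01.
have fE : f = (fun x => (b - a) * h x) \+ cst a.
  by apply/funext => x; rewrite /h /= mulVKf ?gt_eqF// subrK.
have KE K : plin K -> K f = (b - a) * K h + a * K (cst 1).
  move=> linK; rewrite {1}fE plinD//; [|exact: bmeasZ|exact: bmeas_cst].
  by rewrite plinZ// (plin_cst linK a).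
rewrite (KE I)// (KE J)// IJ1.
have := plin_le_indic linI linJ eps0 IJ mh h01.
by rewrite -(ler_pM2l ba0); lra.
Qed.

(** The oscillation bound with zero error, used in both directions. *)
Lemma plin_ext {I J f} : plin I -> plin J ->
  (forall B, measurable B -> I \1_B = J \1_B) ->
  bmeas f -> I f = J f.
Proof.
move=> linI linJ IJ [mf [M fM]].
have fM1 x : - (M + 1) <= f x <= M + 1.
  by rewrite -ler_norml (le_trans (fM x))// lerDl.
(* A point of [T] shows [0 <= M], so that the interval from [- (M + 1)] to [M + 1] has positive
   width; on an empty type [f] is the zero function. *)
have [pt|npt] := pselect (exists x : T, True); last first.
  have -> : f = cst 0 by apply/funext => x; exfalso; apply: npt; exists x.
  by rewrite (plin_cst linI) (plin_cst linJ) !mul0r.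
have [x _] := pt.
have M0 : 0 <= M by exact: le_trans (fM x).
have IJ1 : I (cst 1) = J (cst 1) by rewrite -(indicT T) IJ.
have lt : - (M + 1) < M + 1 by lra.
have IJ0 B : measurable B -> I \1_B <= J \1_B + 0 by move/IJ ->; rewrite addr0.
have JI0 B : measurable B -> J \1_B <= I \1_B + 0 by move/IJ ->; rewrite addr0.
have := plin_le_osc linI linJ (lexx 0) IJ1 IJ0 mf fM1 lt.
have := plin_le_osc linJ linI (lexx 0) (esym IJ1) JI0 mf fM1 lt.
by lra.
Qed.

End BoundedMeasurable.

(** * Expectations of bounded functions *)

Section Expectation.
Context {R : realType} {dT : measure_display} {T : measurableType dT}.
Implicit Types (P : probability T R) (f g : T -> R) (D B : set T).

Lemma bmeas_integrable P D f : measurable D -> bmeas f ->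
  P.-integrable D (EFin \o f).
Proof.
move=> mD [mf [M fM]]; apply: measurable_bounded_integrable => //.
- by rewrite (le_lt_trans (probability_le1 P mD))// ltry.
- exact: measurable_funTS.
- by exists M; split; [exact: num_real | move=> N MN x _ /=; exact/(le_trans (fM x))/ltW].
Qed.

Lemma plin_Rintegral P D : measurable D -> plin (fun f => \int[P]_(x in D) f x).
Proof.
move=> mD; split=> [f g bf bg|a f bf|f g bf bg fg].
- by rewrite RintegralD//; exact: bmeas_integrable.
- by rewrite RintegralZl//; exact: bmeas_integrable.
- by apply: le_Rintegral => //; exact: bmeas_integrable.
Qed.

Lemma Rintegral_indic P D B : measurable D -> measurable B ->
  \int[P]_(x in D) \1_B x = fine (P (B `&` D)).
Proof. by move=> mD mB; rewrite /Rintegral integral_indic. Qed.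

Lemma Rintegral_prob_cst P (a : R) : \int[P]_x a = a.
Proof.
rewrite Rintegral_cst// -[RHS]mulr1; congr (_ * _).
exact: (congr1 fine (probability_setT P)).
Qed.

Lemma EFin_Rintegral P D f : measurable D -> bmeas f ->
  (\int[P]_(x in D) f x)%:E = (\int[P]_(x in D) (f x)%:E)%E.
Proof.
move=> mD bf; rewrite /Rintegral fineK// -integral_fin_num_abs//.
  by have /integrableP[] := bmeas_integrable P D f mD bf.
by case: bf => + _; exact: measurable_funTS.
Qed.

Lemma Rintegral_itv P f a b : measurable_fun setT f ->
  (forall x, a <= f x <= b) -> a <= \int[P]_x f x <= b.
Proof.
move=> mf fab; have bf := bmeas_itv _ _ mf fab.
have linP := plin_Rintegral P setT measurableT.
apply/andP; split.
  rewrite -[leLHS](Rintegral_prob_cst P); apply: (le_plin linP) => //.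
    exact: bmeas_cst.
  by move=> x; have /andP[] := fab x.
rewrite -[leRHS](Rintegral_prob_cst P); apply: (le_plin linP) => //.
  exact: bmeas_cst.
by move=> x; have /andP[] := fab x.
Qed.

End Expectation.

Lemma bmeas_comp {R : realType} {dT dT'} {T : measurableType dT}
    {T' : measurableType dT'} (phi : T -> T') (f : T' -> R) :
  measurable_fun setT phi -> bmeas f -> bmeas (f \o phi).
Proof.
move=> mphi [mf [M fM]]; split; first exact: measurableT_comp.
by exists M => x; exact: fM.
Qed.

Lemma plin_comp {R : realType} {dT dT'} {T : measurableType dT}
    {T' : measurableType dT'} {I : (T -> R) -> R} (phi : T -> T') :
  measurable_fun setT phi -> plin I -> plin (fun f => I (f \o phi)).
Proof.
move=> mphi [ID IZ Ile]; split=> [f g bf bg|a f bf|f g bf bg fg].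
- exact: (ID _ _ (bmeas_comp _ _ mphi bf) (bmeas_comp _ _ mphi bg)).
- exact: (IZ _ _ (bmeas_comp _ _ mphi bf)).
- by apply: Ile => [||x]; [exact: bmeas_comp..|exact: fg].
Qed.

(** * Mixing of the kernel operator *)

Section KernelOperator.
Context {R : realType} {dZ : measure_display} {Z : measurableType dZ}.
Context {Pk : Z -> probability Z R}.
Hypothesis mPk :
  forall B, measurable B -> measurable_fun setT (fun x => Pk x B).
Implicit Types (f g : Z -> R) (B : set Z).

Definition kop (Qk : Z -> probability Z R) f x : R := \int[Qk x]_y f y.
Local Notation Q := (kop Pk).

Lemma kop_itv f a b : measurable_fun setT f ->
  (forall x, a <= f x <= b) -> forall x, a <= Q f x <= b.
Proof. by move=> mf fab x; exact: Rintegral_itv. Qed.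

Lemma kopD f g : bmeas f -> bmeas g -> Q (f \+ g) = Q f \+ Q g.
Proof.
move=> bf bg; apply/funext => x /=.
exact: (plinD (plin_Rintegral (Pk x) setT measurableT)).
Qed.

Lemma kopZ a f : bmeas f -> Q (fun x => a * f x) = (fun x => a * Q f x).
Proof.
move=> bf; apply/funext => x.
exact: (plinZ (plin_Rintegral (Pk x) setT measurableT)).
Qed.

Lemma measurable_kop_ge0 f : measurable_fun setT f -> (forall x, 0 <= f x) ->
  measurable_fun setT (Q f).
Proof.
move=> mf f0; rewrite /kop /Rintegral.
apply: (@measurableT_comp _ _ _ _ _ _ fine); first exact: fine_measurable.
apply: (@measurable_fun_integral_kernel _ _ _ _ _ (fun x => Pk x) _ (EFin \o f)).
- exact: mPk.
- by move=> z; rewrite lee_fin.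
- exact/measurable_EFinP.
Qed.

Lemma bmeas_kop f : bmeas f -> bmeas (Q f).
Proof.
move=> bf; have [mf [M fM]] := bf.
have fMM x : - M <= f x <= M by rewrite -ler_norml.
suff : measurable_fun setT (Q f) by move/bmeas_itv; apply; exact: kop_itv.
(* Reduction to a nonnegative integrand: [Q] preserves constants, so the shift by [M] can be undone
   afterwards. *)
have -> : Q f = Q (f \+ cst M) \+ cst (- M).
  rewrite kopD//; last exact: bmeas_cst.
  by apply/funext => x /=; rewrite /(Q (cst M)) /kop Rintegral_prob_cst addrK.
apply: measurable_funD => //; apply: measurable_kop_ge0.
  exact: measurable_funD.
by move=> x /=; have /andP[] := fMM x; lra.
Qed.

Lemma bmeas_iter_kop n f : bmeas f -> bmeas (iter n Q f).
Proof. by move=> bf; elim: n => //= n IHn; exact: bmeas_kop. Qed.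

Lemma plin_iter_kop n (I : (Z -> R) -> R) :
  plin I -> plin (fun f => I (iter n Q f)).
Proof.
move=> linI; elim: n => [//|n [ID IZ Ile]].
split=> [f g bf bg|a f bf|f g bf bg fg]; rewrite !iterSr.
- by rewrite kopD// ID//; exact: bmeas_kop.
- by rewrite kopZ// IZ//; exact: bmeas_kop.
- apply: Ile; [exact: bmeas_kop..|move=> x].
  exact: (le_plin (plin_Rintegral (Pk x) setT measurableT)).
Qed.

Lemma iter_kop_cst n (a : R) : iter n Q (cst a) = cst a.
Proof.
elim: n => //= n ->; apply/funext => x.
by rewrite /kop Rintegral_prob_cst.
Qed.

(** Both recursions peel off the first transition, hence an induction with the starting point
    free. *)
Lemma kpowE n x B : measurable B ->
  kpow Pk n x B = (iter n Q \1_B x)%:E.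
Proof.
move=> mB; elim: n x => [//|n IHn] x /=.
under eq_integral do rewrite IHn.
by rewrite -EFin_Rintegral//; exact/bmeas_iter_kop/bmeas_indic.
Qed.

Lemma stationary_kop {mu f} : stationary Pk mu -> bmeas f ->
  \int[mu]_x Q f x = \int[mu]_x f x.
Proof.
move=> stat bf; have linmu := plin_Rintegral mu setT measurableT.
apply: (plin_ext (plin_iter_kop 1 _ linmu) linmu _ bf) => /=.
move=> B mB; rewrite Rintegral_indic// setIT stat// /Rintegral.
congr fine; apply: eq_integral => x _.
by rewrite /kop Rintegral_indic// setIT fineK// fin_num_measure.
Qed.

Lemma stationary_iter_kop {mu n f} : stationary Pk mu -> bmeas f ->
  \int[mu]_x iter n Q f x = \int[mu]_x f x.
Proof.
move=> stat bf; elim: n => //= n <-; apply: stationary_kop => //.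
exact: bmeas_iter_kop.
Qed.

(** Total variation at most 1/4 bounds the difference on indicators from both sides; each side
    extends to functions in proportion to the width of their range. *)
Lemma mixing_kop {mu tau f a b x} : mixing_time Pk mu tau ->
  measurable_fun setT f -> (forall y, a <= f y <= b) -> a < b ->
  `|iter tau Q f x - \int[mu]_y f y| <= (b - a) / 4.
Proof.
move=> mix mf fab ab.
have lin1 : plin (fun f => iter tau Q f x).
  by apply: (plin_iter_kop tau (fun f => f x)); split=> // *; done.
have lin2 := plin_Rintegral mu setT measurableT.
have eqc : iter tau Q (cst 1) x = \int[mu]_y cst 1 y.
  by rewrite iter_kop_cst Rintegral_prob_cst.
have ge4 : 0 <= 4^-1 :> R by rewrite invr_ge0.
have h B : measurable B ->
    `|iter tau Q \1_B x - \int[mu]_y \1_B y| <= 4^-1.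
  move=> mB; have := mix x B mB; rewrite kpowE// Rintegral_indic// setIT.
  by rewrite -{1}(fineK (fin_num_measure mu B mB)) -EFinB lee_fin.
have h1 B : measurable B ->
    iter tau Q \1_B x <= \int[mu]_y \1_B y + 4^-1.
  by move=> /h; rewrite ler_norml; lra.
have h2 B : measurable B ->
    \int[mu]_y \1_B y <= iter tau Q \1_B x + 4^-1.
  by move=> /h; rewrite ler_norml; lra.
have := plin_le_osc lin1 lin2 ge4 eqc h1 mf fab ab.
have := plin_le_osc lin2 lin1 ge4 (esym eqc) h2 mf fab ab.
by move=> h3 h4; rewrite ler_norml; apply/andP; split; lra.
Qed.

(** Geometric decay: [tau] steps keep the stationary mean and halve the width of the range, so the
    induction hypothesis is applied to [iter tau Q f]. *)
Lemma mixing_iter_kop {mu tau} k {f a b x} :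
  stationary Pk mu -> mixing_time Pk mu tau ->
  measurable_fun setT f -> (forall y, a <= f y <= b) -> a < b ->
  `|iter (k * tau) Q f x - \int[mu]_y f y| <= (b - a) / 2 ^+ k.
Proof.
move=> stat mix; elim: k f a b => [|k IHk] f a b mf fab ab.
  have /andP[] := Rintegral_itv mu f a b mf fab; have /andP[] := fab x.
  by rewrite mul0n /= expr0 divr1 ler_norml => *; apply/andP; split; lra.
have bf := bmeas_itv _ _ mf fab.
set m := \int[mu]_y f y.
(* The new interval is centred at the stationary mean and has width [(b - a) / 2]. *)
have mfab y : m - (b - a) / 4 <= iter tau Q f y <= m + (b - a) / 4.
  by have := mixing_kop (x := y) mix mf fab ab; rewrite ler_norml -/m; lra.
have [mf' _] := bmeas_iter_kop tau _ bf.
have lt : m - (b - a) / 4 < m + (b - a) / 4 by lra.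
have := IHk _ _ _ mf' mfab lt.
rewrite stationary_iter_kop// -iterD -/m mulSn addnC => /le_trans; apply.
by rewrite exprS invfM; have := invr_ge0 (2 ^+ k : R); lra.
Qed.

End KernelOperator.

(** * The Markov property tested on events of the past *)

Section MarkovChain.
Context {R : realType} {dO : measure_display} {Omega : measurableType dO}.
Context {P : probability Omega R} {F : nat -> set (set Omega)}.
Context {dZ : measure_display} {Z : measurableType dZ}.
Context {Pk : Z -> probability Z R} {z : nat -> Omega -> Z}.
Hypothesis markov : markov_wrt P F Pk z.
Implicit Types (f : Z -> R) (A : set Omega).

Lemma filtration_le {s t A} : (s <= t)%N -> F s A -> F t A.
Proof.
have [_ [_ [FS _]]] := markov => st FA.
by rewrite -(subnKC st); elim: (t - s)%N => [|n IHn]; rewrite ?addn0// addnS; exact: FS.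
Qed.

Lemma measurable_filtration {t A} : F t A -> measurable A.
Proof. by have [_ [+ _]] := markov; apply. Qed.

Lemma measurable_chain t : measurable_fun setT (z t).
Proof.
have [_ [_ [_ [_ [+ _]]]]] := markov => Fz _ B mB.
by rewrite setTI; apply: (measurable_filtration (t := t)); exact: Fz.
Qed.

Lemma measurable_kernel B : measurable B -> measurable_fun setT (fun x => Pk x B).
Proof. by have [_ [_ [_ [+ _]]]] := markov; apply. Qed.

(** Integrals over events of [F t] stand in for conditional expectations; both sides are positive
    linear in [f] and agree on indicators by the Markov property. *)
Lemma markov_kop {t A f} : F t A -> bmeas f ->
  \int[P]_(w in A) f (z t.+1 w) = \int[P]_(w in A) kop Pk f (z t w).
Proof.
move=> FA bf; have mA := measurable_filtration FA.
have linA := plin_Rintegral P A mA.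
have l1 := plin_comp _ (measurable_chain t.+1) linA.
have l2 := plin_iter_kop measurable_kernel 1 _ (plin_comp _ (measurable_chain t) linA).
apply: (plin_ext l1 l2 _ bf) => B mB /=.
have [_ [_ [_ [_ [_ mk]]]]] := markov.
transitivity (fine (P (A `&` z t.+1 @^-1` B))).
  rewrite setIC -(Rintegral_indic P A)//.
  by have := measurable_chain t.+1 measurableT B mB; rewrite setTI.
rewrite mk// /Rintegral; congr fine; apply: eq_integral => w _.
by rewrite /= /kop Rintegral_indic// setIT fineK// fin_num_measure.
Qed.

(** The last transition is traded for one application of the operator; [A] remains an event of the
    past at every intermediate time. *)
Lemma markov_iter_kop {s n A f} : F s A -> bmeas f ->
  \int[P]_(w in A) f (z (s + n)%N w) = \int[P]_(w in A) iter n (kop Pk) f (z s w).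
Proof.
move=> FA; elim: n f => [|n IHn] f bf; first by rewrite addn0.
rewrite addnS markov_kop//; last exact/filtration_le/FA/leq_addr.
by rewrite (IHn (kop Pk f)) -?iterSr//; exact: (bmeas_kop measurable_kernel).
Qed.

(** After [k * tau] further steps the operator is uniformly close to the stationary mean, here zero,
    and the range has width [2 * M]; integrating over [A] keeps the factor [P A]. *)
Lemma markov_mixing_le {mu tau k s A f M} :
  stationary Pk mu -> mixing_time Pk mu tau -> F s A ->
  measurable_fun setT f -> (forall y, - M <= f y <= M) -> 0 < M ->
  \int[mu]_y f y = 0 ->
  \int[P]_(w in A) f (z (s + k * tau)%N w) <= 2 * M / 2 ^+ k * fine (P A).
Proof.
move=> stat mix FA mf fM M0 mu0; have mA := measurable_filtration FA.
have bf := bmeas_itv _ _ mf fM.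
rewrite markov_iter_kop// -(Rintegral_cst P mA).
apply: (le_plin (plin_Rintegral P A mA)) => [||w].
- apply: (bmeas_comp (z s)); first exact: measurable_chain.
  exact: (bmeas_iter_kop measurable_kernel).
- exact: bmeas_cst.
- have lt : - M < M by lra.
  have := mixing_iter_kop measurable_kernel k (x := z s w) stat mix mf fM lt.
  rewrite mu0 subr0 opprK => /(le_trans (ler_norm _)).
  by have -> : 2 * M = M + M by ring.
Qed.

End MarkovChain.

(** * Bias of Markovian samples *)

Section Coordinates.
Context {R : realType} {d : nat}.
Implicit Types u : 'rV[R]_d.

Lemma coord_le_enorm u i : `|u ord0 i| <= enorm u.
Proof.
rewrite -(@ler_pXn2r _ 2) ?nnegrE ?enorm_ge0 ?normr_ge0// enorm_sqr.
rewrite real_normK ?num_real// expr2 /edot (bigD1 i)//= lerDl.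
by apply: sumr_ge0 => j _; rewrite -expr2 sqr_ge0.
Qed.

Lemma enorm_le_coord u s : (forall i, `|u ord0 i| <= s) -> enorm u <= d%:R * `|s|.
Proof.
move=> us; rewrite -(@ler_pXn2r _ 2) ?nnegrE ?enorm_ge0 ?mulr_ge0// enorm_sqr.
have h : edot u u <= d%:R * s ^+ 2.
  rewrite -[in leRHS](card_ord d) mulr_natl -sumr_const.
  apply: ler_sum => i _; rewrite -expr2 -(real_normK (num_real (u ord0 i))).
  by apply: lerXn2r; rewrite ?nnegrE ?(le_trans _ (us i)).
rewrite (le_trans h)// exprMn real_normK ?num_real// ler_wpM2r ?sqr_ge0//.
(* The factor [d] is cruder than its square root, but a grid of arbitrary mesh absorbs it later. *)
by rewrite -natrX ler_nat; case: (d) => // n; rewrite leq_pmulr.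
Qed.

End Coordinates.

Lemma sigma_algebra_bigcap_ord {T : Type} {d : nat} {F : set (set T)}
    {A : 'I_d -> set T} : sigma_algebra setT F -> (forall i, F (A i)) ->
  F (\bigcap_(i in [set: 'I_d]) A i).
Proof.
move=> [F0 FD FU] FA.
pose B k := if insub k is Some i then setT `\` A i else set0.
(* De Morgan, with the finite family of complements padded by empty sets into a sequence. *)
have -> : \bigcap_(i in [set: 'I_d]) A i = setT `\` \bigcup_k B k.
  apply/seteqP; split => x /= h.
    split=> // -[k _]; rewrite /B; case: insubP => // i _ _ [_]; apply.
    exact: h.
  move=> i _; apply: contrapT => nAx; case: h => _; apply.
  by exists i => //; rewrite /B valK.
by apply/(FD)/FU => k; rewrite /B; case: insubP => // i _ _; exact/FD.
Qed.

Section Quantize.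
Context {R : realType} {Omega : Type} {d : nat}.

(** Truncating the coordinates on a grid cuts the bounded range of [X] into finitely many cells,
    whose preimages are finite intersections of events of [F]. *)
Lemma quantize {F : set (set Omega)} {X : Omega -> 'rV[R]_d}
    {C : set 'rV[R]_d} {b delta : R} {x0} :
  sigma_algebra setT F ->
  (forall (i : 'I_d) (B : set R), measurable B ->
    F ((fun w => X w ord0 i) @^-1` B)) ->
  C x0 -> (forall w, C (X w)) -> (forall x, C x -> enorm x <= b) -> 0 < delta ->
  exists (J : finType) (q : Omega -> J) (r : J -> 'rV[R]_d),
    [/\ forall j, F (q @^-1` [set j]), forall j, C (r j)
      & forall w, enorm (X w - r (q w)) <= delta].
Proof.
move=> sF FX Cx0 CX Cb delta0.
(* The mesh is [1 / n], and [n] is large enough for [d / n <= delta]. *)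
pose n := (Num.truncn (d%:R / delta)).+1.
have n0 : 0 < n%:R :> R by [].
have dn : d%:R * n%:R^-1 <= delta.
  by rewrite ler_pdivrMr// mulrC -ler_pdivrMr// ltW// truncnS_gt.
pose y w i := (X w ord0 i + b) * n%:R.
have y0 w i : 0 <= y w i.
  rewrite mulr_ge0//; have := le_trans (coord_le_enorm (X w) i) (Cb _ (CX w)).
  by rewrite ler_norml; lra.
pose m := Num.truncn (2 * b * n%:R).
have ym w i : (Num.truncn (y w i) <= m)%N.
  apply: le_truncn; rewrite ler_pM2r//.
  have := le_trans (coord_le_enorm (X w) i) (Cb _ (CX w)).
  by rewrite ler_norml; lra.
(* By [ym] every truncation fits below [m.+1], so [inord] merges no cells. *)
pose q w : {ffun 'I_d -> 'I_m.+1} := [ffun i => inord (Num.truncn (y w i))].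
have qE w i (k : 'I_m.+1) : (q w i == k) = (k%:R <= y w i < k.+1%:R).
  by rewrite ffunE -val_eqE /= inordK ?ltnS ?ym// truncn_eq.
(* Each nonempty cell is represented by an actual value of [X], which keeps [r j] in [C]; [x0]
   serves the empty cells. *)
pose r j := match pselect (exists w, q w = j) with
  | left e => X (projT1 (cid e)) | right _ => x0 end.
exists _, q, r; split=> [j|j|w].
- have -> : q @^-1` [set j] = \bigcap_(i in [set: 'I_d])
      (fun w => X w ord0 i) @^-1`
        `[(j i)%:R / n%:R - b, (j i).+1%:R / n%:R - b[.
    have ijE w i : (q w i == j i) =
        (X w ord0 i \in `[(j i)%:R / n%:R - b, (j i).+1%:R / n%:R - b[).
      by rewrite qE in_itv /= lerBlDr ltrBrDr ler_pdivrMr// ltr_pdivlMr.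
    apply/seteqP; split => w /=.
      by move=> e i _; have := ijE w i; rewrite e eqxx => /esym.
    by move=> h; apply/ffunP => i; apply/eqP; rewrite ijE; exact: h.
  by apply: sigma_algebra_bigcap_ord => // i; apply: FX; exact: measurable_itv.
- by rewrite /r; case: pselect => // e; exact: CX.
- rewrite /r; case: pselect => [e|]; last by case; exists w.
  set w' := projT1 (cid e); have qw' : q w' = q w := projT2 (cid e).
  apply: le_trans dn; rewrite -[n%:R^-1]ger0_norm ?invr_ge0//.
  apply: enorm_le_coord => i; rewrite !mxE.
  have := qE w i (q w i); have := qE w' i (q w i); rewrite qw' eqxx => /esym h1 /esym h2.
  have -> : X w ord0 i - X w' ord0 i = (y w i - y w' i) / n%:R.
    by rewrite /y -mulrBl mulfK ?gt_eqF//; ring.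
  rewrite normrM [X in _ * X]ger0_norm ?invr_ge0// -[leRHS]mul1r ler_wpM2r ?invr_ge0//.
  by move: h1 h2; rewrite ler_norml -!natr1; lra.
Qed.

End Quantize.

Section MarkovianBias.
Context {R : realType} {d : nat} {dO : measure_display} {Omega : measurableType dO}.
Context {P : probability Omega R} {F : nat -> set (set Omega)}.
Context {dZ : measure_display} {Z : measurableType dZ}.
Context {Pk : Z -> probability Z R} {z : nat -> Omega -> Z}.

(* [H] is not assumed jointly measurable, so [w |-> H (X w) (z t w)] may fail to be measurable;
   quantizing [X] yields a measurable majorant. *)
Lemma markov_bias_majorant {mu tau k s} {C : set 'rV[R]_d} {X : Omega -> 'rV[R]_d}
    {H : 'rV[R]_d -> Z -> R} {b M L delta x0} :
  markov_wrt P F Pk z -> stationary Pk mu -> mixing_time Pk mu tau ->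
  vmeas_wrt (F s) X -> C x0 -> (forall w, C (X w)) ->
  (forall x, C x -> enorm x <= b) ->
  (forall x, C x -> measurable_fun setT (H x)) ->
  (forall x y, C x -> - M <= H x y <= M) -> 0 < M ->
  (forall x x' y, C x -> C x' -> H x y - H x' y <= L * enorm (x - x')) -> 0 <= L ->
  (forall x, C x -> \int[mu]_y H x y = 0) -> 0 < delta ->
  exists U : Omega -> R, [/\ bmeas U,
    forall w, H (X w) (z (s + k * tau)%N w) <= U w
    & \int[P]_w U w <= 2 * M / 2 ^+ k + L * delta].
Proof.
move=> mkv stat mix FX Cx0 CX Cb mH HM M0 HL L0 H0 delta0.
have [sF _] := mkv.
have [J [q [r [Fq Cr Xr]]]] := quantize (sF s) FX Cx0 CX Cb delta0.
set t := (s + k * tau)%N.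
pose A j := q @^-1` [set j].
have mA j : measurable (A j) by apply: (measurable_filtration mkv); exact: Fq.
(* On the cell [A j] the parameter is frozen at [r j], leaving a measurable function of the chain
   alone; the constant [L * delta] will pay for the freezing. *)
pose V j w := H (r j) (z t w) * \1_(A j) w.
have bH j : bmeas (H (r j) \o z t).
  apply: (bmeas_comp _ _ (measurable_chain mkv t)).
  exact: (bmeas_itv _ _ (mH _ (Cr j)) (fun y => HM _ y (Cr j))).
have bV j : bmeas (V j).
  have [mHz [B HB]] := bH j; have [m1 _] := bmeas_indic (R := R) _ (mA j).
  split; first exact: measurable_funM.
  exists B => w; rewrite normrM indicE normr_nat (le_trans _ (HB w))//.
  by rewrite ler_piMr// lern1 leq_b1.
have bsV : bmeas (fun w => \sum_j V j w) := bmeas_sum _ _ _ bV.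
have linP := plin_Rintegral P setT measurableT.
exists ((fun w => \sum_j V j w) \+ cst (L * delta)); split.
- exact/bmeasD/bmeas_cst.
- move=> w /=; rewrite (bigD1 (q w))//= big1 => [|j jq]; last first.
    by rewrite /V indicE memNset ?mulr0//= => e; rewrite -e eqxx in jq.
  rewrite addr0 /V indicE mem_set// mulr1 addrC -lerBlDr.
  by rewrite (le_trans (HL _ _ _ (CX w) (Cr _)))// ler_wpM2l.
- rewrite (plinD linP) ?Rintegral_prob_cst ?lerD2r//; last exact: bmeas_cst.
  rewrite (plin_sum linP)//.
  (* The cells partition the space, so the bound is distributed according to their probabilities. *)
  have -> : 2 * M / 2 ^+ k = \sum_j 2 * M / 2 ^+ k * fine (P (A j)).
    rewrite -mulr_sumr -[LHS]mulr1; congr (_ * _).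
    rewrite -[LHS](Rintegral_prob_cst P).
    under [RHS]eq_bigr do rewrite -[A _]setIT -(Rintegral_indic P)//.
    rewrite -(plin_sum linP) => [|j]; last exact: bmeas_indic.
    congr (Rintegral P setT _); apply/funext => w.
    rewrite (bigD1 (q w))//= big1 => [|j jq]; last first.
      by rewrite indicE memNset//= => e; rewrite -e eqxx in jq.
    by rewrite addr0 indicE mem_set.
  apply: ler_sum => j _.
  have := markov_mixing_le (k := k) mkv stat mix (Fq j) (mH _ (Cr j))
    (fun y => HM _ y (Cr j)) M0 (H0 _ (Cr j)).
  by rewrite Rintegral_mkcond patch_indic.
Qed.

End MarkovianBias.

(** * Step sizes and harmonic sums *)

Section Logarithm.
Context {R : realType}.

Lemma ln2_ge : 2^-1 <= ln 2 :> R.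
Proof.
have := @le_ln1Dx R (- 2^-1) ltac:(lra).
have -> : 1 + - 2^-1 = 2^-1 :> R by lra.
by rewrite lnV ?posrE//; lra.
Qed.

Lemma lnn_ge {n : nat} : (2 <= n)%N -> 2^-1 <= ln n%:R :> R.
Proof.
move=> n2; apply: le_trans ln2_ge _.
by rewrite ler_ln ?posrE ?ltr0n ?ler_nat//; lia.
Qed.

(** Each increment satisfies [1 / (n + 2) <= ln (n + 2) - ln (n + 1)], by [ln (1 + x) <= x] at
    [x = - 1 / (n + 2)]. *)
Lemma harmonic_le_ln (n : nat) :
  \sum_(1 <= s < n.+2) s%:R^-1 <= 1 + ln n.+1%:R :> R.
Proof.
elim: n => [|n IHn]; first by rewrite big_nat1 invr1 ln1 addr0.
rewrite big_nat_recr//= (le_trans (lerD IHn (lexx _)))// -addrA lerD2l.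
have h : -1 < - n.+2%:R^-1 :> R by rewrite ltrN2 invf_lt1// ltr1n.
have := le_ln1Dx h.
have -> : 1 - n.+2%:R^-1 = n.+1%:R / n.+2%:R :> R.
  by rewrite -[n.+1%:R](addrK 1) natr1 mulrBl divff ?pnatr_eq0// mul1r.
rewrite ln_div ?posrE// lerBlDr => h1.
by rewrite -lerBrDr (le_trans h1)// addrC.
Qed.

Lemma harmonic_le_lnW (n T : nat) : (n <= T)%N -> (0 < T)%N ->
  \sum_(1 <= s < n.+1) s%:R^-1 <= 1 + ln T%:R :> R.
Proof.
move=> nT T0; apply: (@le_trans _ _ (\sum_(1 <= s < T.+1) s%:R^-1)).
  rewrite [leRHS](@big_cat_nat _ _ _ n.+1)//= lerDl.
  by apply: sumr_ge0 => s _; rewrite invr_ge0.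
by case: T T0 {nT} => // T _; exact: harmonic_le_ln.
Qed.

(** If the rounded-up logarithm is [k + 1], then [2 ^ k < n] gives [k <= 2 * ln n], and the extra 1
    is at most [2 * ln n] too. *)
Lemma up_log2_le_ln {n : nat} : (2 <= n)%N -> (up_log 2 n)%:R <= 4 * ln n%:R :> R.
Proof.
move=> n2; have ln_n := lnn_ge n2.
have := up_log_gtn (isT : 1 < 2)%N n2; have : (0 < up_log 2 n)%N by rewrite up_log_gt0.
case: (up_log 2 n) => // k _ /= kn.
have h : ln 2 * k%:R <= ln n%:R :> R.
  rewrite mulr_natr -lnXn// -natrX ler_ln ?posrE ?ltr0n ?ler_nat ?expn_gt0//.
    exact: ltnW.
  exact: ltnW.
by have := ler_wpM2r (ler0n R k) ln2_ge; rewrite -[k.+1%:R]natr1; lra.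
Qed.

End Logarithm.

Section StepSizes.
Context {R : realType} {c : R} {eta : nat -> R}.
Hypothesis c0 : 0 < c.
Hypothesis eta1_ge : c^-1 <= eta 1.
Hypothesis eta1_le : eta 1 <= 2 / c.
Hypothesis etaS : forall t, (1 <= t)%N ->
  eta t.+1 = expR (- (c * eta t / 2)) * eta t.

Lemma eta_gt0 t : (1 <= t)%N -> 0 < eta t.
Proof.
elim: t => // -[_ _|t IHt _]; first by rewrite (lt_le_trans _ eta1_ge)// invr_gt0.
by rewrite etaS// mulr_gt0 ?expR_gt0 ?IHt.
Qed.

(** The reciprocal is multiplied by [expR (c * eta t / 2) >= 1 + c * eta t / 2], so it grows by at
    least [c / 2] per step. *)
Lemma eta_inv_ge t : (1 <= t)%N -> c * t%:R / 2 <= (eta t)^-1.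
Proof.
elim: t => // -[_ _|t IHt _].
  have h : eta 1 * c <= 2 by rewrite -ler_pdivlMr.
  rewrite mulr1 -[leRHS]mul1r ler_pdivlMr ?eta_gt0//; lra.
have e0 := eta_gt0 t.+1 isT.
rewrite etaS// invfM -expRN opprK ler_pdivlMr//.
have := IHt isT; rewrite -[X in _ <= X]mul1r ler_pdivlMr// => h.
have := expR_ge1Dx (c * eta t.+1 / 2); rewrite -[t.+2%:R]natr1; lra.
Qed.

Lemma eta_le t : (1 <= t)%N -> eta t <= 2 / c / t%:R.
Proof.
move=> t1; have e0 := eta_gt0 t t1; have := eta_inv_ge t t1.
have t0 : 0 < t%:R :> R by rewrite ltr0n.
rewrite -[X in _ <= X]mul1r ler_pdivlMr// => h.
by rewrite !ler_pdivlMr//; lra.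
Qed.

Lemma eta_le_succ t : (1 <= t)%N -> eta t <= 4 * eta t.+1.
Proof.
move=> t1; have e0 := eta_gt0 t t1; rewrite etaS// mulrA -[leLHS]mul1r ler_pM2r//.
have ce : c * eta t <= 2.
  have := eta_le t t1; rewrite ler_pdivlMr ?ltr0n// ler_pdivlMr// => h.
  apply: le_trans h; rewrite mulrC -mulrA ler_wpM2l ?(ltW e0)//.
  by rewrite -[leLHS]mul1r ler_wpM2r ?(ltW c0)// ler1n.
(* As [x <= 1/2], each of the two factors [expR (- x)] is at least 1/2; their product yields the
   constant 4. *)
set x := c * eta t / 4.
have -> : - (c * eta t / 2) = - x + - x by rewrite /x; lra.
have h := expR_ge1Dx (- x); have hx : 2^-1 <= expR (- x) by rewrite /x in h *; lra.
have hh : 2^-1 * 2^-1 <= expR (- x) * expR (- x).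
  by apply: ler_pM => //; rewrite invr_ge0.
by rewrite expRD; lra.
Qed.

(** The contraction factor equals [eta t.+1 / eta t], so [D t / eta t] telescopes; the factor 4
    comes from dividing [eta t * r t] by [eta t.+1]. *)
Lemma contracting_recursion {D r : nat -> R} :
  (forall t, (1 <= t)%N -> 0 <= r t) ->
  (forall t, (1 <= t)%N ->
    D t.+1 <= expR (- (c * eta t / 2)) * D t + eta t * r t) ->
  forall n, D n.+1 <= eta n.+1 * (D 1%N / eta 1%N + 4 * \sum_(1 <= t < n.+1) r t).
Proof.
move=> r0 DS; elim=> [|n IHn].
  by rewrite big_geq// mulr0 addr0 mulrC divfK// gt_eqF// eta_gt0.
rewrite (le_trans (DS n.+1 isT))// big_nat_recr//=.
rewrite [4 * _]mulrDr addrA [leRHS]mulrDr.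
apply: lerD.
  rewrite [X in _ <= X * _]etaS// -[leRHS]mulrA; apply: ler_wpM2l; [exact: expR_ge0|exact: IHn].
rewrite mulrA [_ * 4]mulrC; apply: ler_wpM2r; first exact: r0.
exact: eta_le_succ.
Qed.

End StepSizes.

Lemma sum_bias_le {R : realType} {M K e : R} {m : nat} (n : nat) :
  0 <= M -> 0 <= e ->
  \sum_(1 <= t < n.+1) (if (t <= m)%N then M else e + K / (t - m)%:R) <=
  M * m%:R + e * n%:R + K * \sum_(1 <= s < (n - m).+1) s%:R^-1.
Proof.
move=> M0 e0.
(* The induction requires the exact number [minn n m] of early terms; truncated subtraction empties
   the harmonic sum while [n <= m]. *)
suff h : \sum_(1 <= t < n.+1) (if (t <= m)%N then M else e + K / (t - m)%:R) <=
  M * (minn n m)%:R + e * n%:R + K * \sum_(1 <= s < (n - m).+1) s%:R^-1.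
  by rewrite (le_trans h)// !lerD2r ler_wpM2l// ler_nat geq_minr.
elim: n => [|n IHn].
  by rewrite !big_geq ?sub0n// min0n !mulr0 !addr0.
rewrite big_nat_recr//= (le_trans (lerD IHn (lexx _)))//.
have [nm|mn] := leqP m n; last first.
  rewrite (minn_idPl mn).
  have /eqP -> : (n.+1 - m == 0)%N by rewrite subn_eq0.
  have /eqP -> : (n - m == 0)%N by rewrite subn_eq0 ltnW.
  by rewrite -![n.+1%:R]natr1; lra.
rewrite /= (minn_idPr (leqW nm)) subSn//.
rewrite [X in _ <= _ + K * X]big_nat_recr//= -[n.+1%:R]natr1.
by set u := (n - m).+1%:R^-1; lra.
Qed.

(** * One step of the recursion *)

Section MeanField.
Context {R : realType} {dZ : measure_display} {Z : measurableType dZ} {d : nat}.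
Context {mu : probability Z R} {g : 'rV[R]_d -> Z -> 'rV[R]_d}.
Context {C : set 'rV[R]_d} {C0 G : R}.
Hypothesis mg : forall x (i : 'I_d), measurable_fun setT (fun y => g x y ord0 i).
Hypothesis gC0 : forall x y, C x -> enorm (g x y) <= C0.
Hypothesis G0 : 0 <= G.
Hypothesis gG : forall y x x', C x -> C x' ->
  enorm (g x y - g x' y) <= G * enorm (x - x').

Lemma bmeas_coord x i : C x -> bmeas (fun y => g x y ord0 i).
Proof.
move=> Cx; split=> //; exists C0 => y.
exact: le_trans (coord_le_enorm _ _) (gC0 x y Cx).
Qed.

Lemma bmeas_edot_field v x : C x -> bmeas (fun y => edot v (g x y)).
Proof. by move=> Cx; apply: bmeas_sum => i; exact/bmeasZ/bmeas_coord. Qed.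

Lemma Rintegral_edot v x : C x -> \int[mu]_y edot v (g x y) = edot v (gbar mu g x).
Proof.
move=> Cx; have linmu := plin_Rintegral mu setT measurableT.
rewrite (plin_sum linmu) => [|i]; last exact/bmeasZ/bmeas_coord.
by apply: eq_bigr => i _; rewrite (plinZ linmu) ?mxE//; exact: bmeas_coord.
Qed.

(** Pairing the difference [v] with itself reduces the vector-valued integral to a scalar one,
    bounded pointwise by [enorm v * (G * enorm (x - x'))]. *)
Lemma gbar_lipschitz x x' : C x -> C x' ->
  enorm (gbar mu g x - gbar mu g x') <= G * enorm (x - x').
Proof.
move=> Cx Cx'; set v := gbar mu g x - gbar mu g x'.
have linmu := plin_Rintegral mu setT measurableT.
have [v0|v0] := eqVneq (enorm v) 0.
  by rewrite v0 mulr_ge0 ?enorm_ge0.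
have vp : 0 < enorm v by rewrite lt_def v0 enorm_ge0.
rewrite -(ler_pM2l vp) -expr2 enorm_sqr {2}/v edotBr -!Rintegral_edot//.
rewrite lerBlDl -[X in _ + X](Rintegral_prob_cst mu) -(plinD linmu).
- apply: (le_plin linmu) => [||y /=]; first exact: bmeas_edot_field.
    by apply: bmeasD; [exact: bmeas_edot_field|exact: bmeas_cst].
  rewrite -lerBlDl -edotBr (le_trans (edot_le _ _))// ler_wpM2l ?enorm_ge0//.
  exact: gG.
- exact: bmeas_edot_field.
- exact: bmeas_cst.
Qed.

End MeanField.

(** Contraction supplies a decrease of [2 * c * eta * n ^ 2]. Young's inequality ([h5]) spends half
    of it on the error [e], and the rest covers [1 - expR (- (c * eta / 2)) <= c * eta / 2]. *)
Lemma projected_step {R : realType} {d : nat} {C : set 'rV[R]_d}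
    {x p ths gb gv gh : 'rV[R]_d} {c eta e C0 : R} :
  is_convex_set C -> C ths -> is_proj C (x - eta *: gh) p ->
  0 < c -> 0 < eta -> enorm gh <= C0 -> enorm (gv - gh) <= e ->
  c * enorm (x - ths) ^+ 2 <= edot (x - ths) gb ->
  enorm (p - ths) ^+ 2 <= expR (- (c * eta / 2)) * enorm (x - ths) ^+ 2 +
    eta * (2 * edot (x - ths) (gb - gv) + (e ^+ 2 / c + eta * C0 ^+ 2)).
Proof.
move=> cC Cths pp c0 e0 ghC0 ghe contr.
set n := enorm (x - ths) in contr *.
have n0 : 0 <= n by exact: enorm_ge0.
have h1 : enorm (p - ths) ^+ 2 <= enorm (x - eta *: gh - ths) ^+ 2.
  by rewrite lerXn2r ?nnegrE ?enorm_ge0//; exact: proj_nonexp cC pp Cths.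
have h2 : enorm (x - eta *: gh - ths) ^+ 2 =
    n ^+ 2 - 2 * (eta * edot (x - ths) gh) + eta ^+ 2 * enorm gh ^+ 2.
  by rewrite addrAC enorm_sqrB edotZr (enormZ _ _ (ltW e0)) exprMn.
have h3 : enorm gh ^+ 2 <= C0 ^+ 2.
  by rewrite lerXn2r ?nnegrE ?enorm_ge0 ?(le_trans _ ghC0)// enorm_ge0.
have h4 : edot (x - ths) (gv - gh) <= n * e.
  by rewrite (le_trans (edot_le _ _))// ler_wpM2l.
have h5 : 2 * (n * e) <= c * n ^+ 2 + e ^+ 2 / c.
  have := sqr_ge0 (c * n - e); rewrite -(ler_pM2l c0) => h.
  have -> : c * n ^+ 2 + e ^+ 2 / c = (c ^+ 2 * n ^+ 2 + e ^+ 2) / c.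
    by field; rewrite gt_eqF.
  by rewrite ler_pdivlMr//; move: h; rewrite mulr0 pmulr_rge0//; lra.
have h6 := expR_ge1Dx (- (c * eta / 2)).
have h7 := ler_wpM2r (sqr_ge0 n) h6.
have h8 := ler_wpM2l (sqr_ge0 eta) h3.
have -> : gb - gv = gb - gh - (gv - gh) by rewrite opprB addrA subrK.
rewrite [edot _ (gb - gh - _)]edotBr [edot _ (gb - gh)]edotBr.
set A := edot _ gb in contr *; set B := edot _ gh in h2 *.
set D := edot _ _ in h4 *.
have h9 : eta * (2 * (c * n ^+ 2) + 2 * D) <= eta * (2 * A + (c * n ^+ 2 + e ^+ 2 / c)).
  by rewrite ler_pM2l//; lra.
have h10 : 0 <= c * eta * n ^+ 2 by rewrite mulr_ge0 ?sqr_ge0 ?mulr_ge0 ?ltW.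
lra.
Qed.

Section ExpectedStep.
Context {R : realType} {dO : measure_display} {Omega : measurableType dO}.
Context {P : probability Omega R} {D D' e h U : Omega -> R} {q eta c b k B : R}.

(** Only the majorant [U] is integrated, never [h], whose measurability is not assumed. The square
    of [e] is integrable but possibly unbounded, so it is split off as [W] from the bounded part
    [V]. *)
Lemma expected_step : bmeas D -> bmeas D' -> bmeas U ->
  measurable_fun setT e -> (\int[P]_w (e w ^+ 2)%:E < +oo)%E ->
  0 < eta -> 0 < c ->
  (forall w, D' w <= q * D w + eta * (2 * h w + (e w ^+ 2 / c + k))) ->
  (forall w, h w <= U w) -> \int[P]_w U w <= B ->
  \int[P]_w D' w <= q * \int[P]_w D w +
    eta * (2 * B + (fine (\int[P]_w (e w ^+ 2)%:E) / c + k)).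
Proof.
move=> bD bD' bU me ie eta0 c0 step hU UB.
have linP := plin_Rintegral P setT measurableT.
have inte : P.-integrable setT (EFin \o (fun w => e w ^+ 2)).
  apply/integrableP; split; first exact/measurable_EFinP/measurable_funX.
  by under eq_integral do rewrite /= ger0_norm ?sqr_ge0//.
pose V w := q * D w + (eta * 2) * U w + eta * k.
have bqU : bmeas (fun w => q * D w + (eta * 2) * U w).
  by apply: bmeasD; exact: bmeasZ.
have bV : bmeas V by apply: bmeasD => //; exact: bmeas_cst.
have iV : P.-integrable setT (EFin \o V) by exact: bmeas_integrable.
pose W w := (eta / c) * e w ^+ 2.
have iW : P.-integrable setT (EFin \o W).
  by have := integrableZl measurableT (eta / c) inte; apply: eq_integrable.
apply: (@le_trans _ _ (\int[P]_w (V w + W w))).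
  apply: le_Rintegral => //; first exact: bmeas_integrable.
    by have := integrableD measurableT iV iW; apply: eq_integrable.
  move=> w _; apply: (le_trans (step w)); rewrite /V /W.
  have := hU w; rewrite -(ler_pM2l eta0); lra.
rewrite RintegralD// RintegralZl//.
rewrite /V (plinD linP) ?Rintegral_prob_cst//; last exact: bmeas_cst.
rewrite (plinD linP) ?(plinZ linP)//; do ?exact: bmeasZ.
by rewrite -/(Rintegral P setT _); move: UB; rewrite -(ler_pM2l eta0); lra.
Qed.

End ExpectedStep.

(** * Collecting the constants *)

Lemma prod5_le {R : realType} {S x1 x2 x3 x4 x5 : R} :
  0 <= x1 <= S -> 0 <= x2 <= S -> 0 <= x3 <= S -> 0 <= x4 <= S -> 0 <= x5 <= S ->
  0 <= x1 * x2 * x3 * x4 * x5 <= S ^+ 5.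
Proof.
move=> /andP[? ?] /andP[? ?] /andP[? ?] /andP[? ?] /andP[? ?].
have -> : S ^+ 5 = S * S * S * S * S by ring.
by rewrite !mulr_ge0 ?ler_pM// !mulr_ge0.
Qed.

(** Expansion leaves seven terms. Their coefficients are monomials of degree at most five, hence
    below [W] after padding with ones; their time factors, apart from [X], are multiples of [Y]
    because [l >= 1/2] and [tau >= 1]. The multiples of [W * Y] add up to 6912. *)
Lemma rate_constant_le {R : realType} {c C0 C1 G l tau m X : R} :
  0 < c -> 0 < C0 -> 0 < C1 -> 0 < G -> 2^-1 <= l -> 1 <= tau ->
  0 <= m <= 4 * l * tau -> 0 <= X ->
  2 / c * (4 * C1 ^+ 2 * c + 4 *
    (2 * (4 * C0 * C1 * m + 2 * (4 * C0 * C1) +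
          2 * (2 * C0 + 4 * C1 * G) * C0 * m / c * (1 + l)) +
     (X / c + 2 / c * (1 + l) * C0 ^+ 2)))
  <= 7000 * (1 + C0 + C1 + G + c + c^-1) ^+ 5 * (tau ^+ 2 * l ^+ 3 + X).
Proof.
move=> c0 C00 C10 G0 l2 tau1 /andP[m0 ml] X0.
have ci0 : 0 < c^-1 by rewrite invr_gt0.
have ciK : c * c^-1 = 1 by rewrite divff ?gt_eqF.
set i := c^-1 in ci0 ciK *; set S := 1 + C0 + C1 + G + c + i; set W := S ^+ 5.
have -> : 2 * i * (4 * C1 ^+ 2 * c + 4 *
    (2 * (4 * C0 * C1 * m + 2 * (4 * C0 * C1) +
          2 * (2 * C0 + 4 * C1 * G) * C0 * m * i * (1 + l)) +
     (X * i + 2 * i * (1 + l) * C0 ^+ 2))) =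
  8 * C1 ^+ 2 + 64 * (i * C0 * C1 * m) + 128 * (i * C0 * C1) +
  64 * (i * i * C0 * C0 * (m * (1 + l))) + 128 * (i * i * C0 * C1 * G * (m * (1 + l))) +
  8 * (i * i * X) + 16 * (i * i * C0 * C0 * (1 + l)).
  have -> : 8 * C1 ^+ 2 = 8 * C1 ^+ 2 * (c * i) by rewrite ciK mulr1.
  ring.
have S1 : 0 <= (1 : R) <= S by apply/andP; split; [exact: ler01|rewrite /S; lra].
have SC0 : 0 <= C0 <= S by apply/andP; split; [exact: ltW|rewrite /S; lra].
have SC1 : 0 <= C1 <= S by apply/andP; split; [exact: ltW|rewrite /S; lra].
have SG : 0 <= G <= S by apply/andP; split; [exact: ltW|rewrite /S; lra].
have Si : 0 <= i <= S by apply/andP; split; [exact: ltW|rewrite /S; lra].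
set Y := tau ^+ 2 * l ^+ 3.
have l0 : 0 <= l by lra.
have tauY : tau * l ^+ 3 <= Y by rewrite ler_wpM2r ?exprn_ge0// ler_eXnr.
have l3 : l ^+ 3 <= tau * l ^+ 3 by rewrite ler_peMl ?exprn_ge0.
have ll : l <= 4 * l ^+ 3 by nra.
have ll2 : l ^+ 2 <= 2 * l ^+ 3 by nra.
have Y1 : 1 <= 8 * Y by lra.
have Yl : 1 + l <= 12 * Y by lra.
have Ym : m <= 16 * Y.
  have : l * tau <= 4 * l ^+ 3 * tau by rewrite ler_wpM2r//; lra.
  by lra.
have Yml : m * (1 + l) <= 24 * Y.
  have : m * (1 + l) <= 4 * l * tau * (3 * l) by apply: ler_pM => //; lra.
  have : l ^+ 2 * tau <= 2 * l ^+ 3 * tau by rewrite ler_wpM2r//; lra.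
  by lra.
have bound x y u (xW : 0 <= x <= W) (y0 : 0 <= y) (yu : y <= u * Y) : x * y <= u * (W * Y).
  by case/andP: xW => x0 xW; rewrite mulrCA ler_pM.
have ml0 : 0 <= m * (1 + l) by rewrite mulr_ge0//; lra.
have b1 := bound _ _ _ (prod5_le SC1 SC1 S1 S1 S1) ler01 Y1.
have b2 := bound _ _ _ (prod5_le Si SC0 SC1 S1 S1) m0 Ym.
have b3 := bound _ _ _ (prod5_le Si SC0 SC1 S1 S1) ler01 Y1.
have b4 := bound _ _ _ (prod5_le Si Si SC0 SC0 S1) ml0 Yml.
have b5 := bound _ _ _ (prod5_le Si Si SC0 SC1 SG) ml0 Yml.
have b6 : i * i * 1 * 1 * 1 * X <= W * X.
  by rewrite ler_wpM2r//; case/andP: (prod5_le Si Si S1 S1 S1).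
have l10 : 0 <= 1 + l by lra.
have b7 := bound _ _ _ (prod5_le Si Si SC0 SC0 S1) l10 Yl.
have W0 : 0 <= W by rewrite exprn_ge0//; case/andP: S1; lra.
have Y0 : 0 <= Y by lra.
have := mulr_ge0 W0 Y0; have := mulr_ge0 W0 X0.
rewrite !mulr1 in b1 b2 b3 b4 b6 b7; rewrite -!mulrA in b1 b2 b3 b4 b5 b6 b7 *; rewrite expr2.
move: (W * Y) (W * X) b1 b2 b3 b4 b5 b6 b7 => WY WX *.
lra.
Qed.

Lemma bmeas_sqr_dist {R : realType} {dO} {Omega : measurableType dO} {d : nat}
    {X : Omega -> 'rV[R]_d} {x0 : 'rV[R]_d} {b : R} :
  (forall (i : 'I_d) (B : set R), measurable B ->
    measurable ((fun w => X w ord0 i) @^-1` B)) ->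
  (forall w, enorm (X w - x0) <= b) -> bmeas (fun w => enorm (X w - x0) ^+ 2).
Proof.
move=> mX Xb; split; last first.
  exists (b ^+ 2) => w; rewrite ger0_norm ?sqr_ge0//.
  by rewrite lerXn2r ?nnegrE ?enorm_ge0// (le_trans _ (Xb w))// enorm_ge0.
under eq_fun do rewrite enorm_sqr; apply: measurable_sum => i.
have mi : measurable_fun setT (fun w => (X w - x0) ord0 i).
  under eq_fun do rewrite mxE; apply: measurable_funD => //.
  by move=> _ B mB; rewrite setTI; exact: mX.
exact: measurable_funM.
Qed.

Lemma iterates_dist {R : realType} {d : nat} {x : nat -> 'rV[R]_d} {s : nat} {a : R} :
  (forall t, (s <= t)%N -> enorm (x t.+1 - x t) <= a) ->
  forall m, enorm (x (s + m)%N - x s) <= m%:R * a.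
Proof.
move=> xa; elim=> [|m IHm].
  by rewrite addn0 subrr -(scale0r 0) enormZ// !mul0r.
rewrite addnS -(subrK (x (s + m)%N) (x _.+1)) -addrA.
rewrite (le_trans (enormD _ _))// -natr1 mulrDl mul1r [leRHS]addrC lerD//.
exact/xa/leq_addr.
Qed.

(** * Assembly of the convergence rate *)

Theorem theorem2 (R : realType) :
  exists (a : R) (N : nat), 0 <= a /\
  forall (c C0 C1 G : R), 0 < c -> 0 < C0 -> 0 < C1 -> 0 < G ->
  let K := a * (1 + C0 + C1 + G + c + c^-1) ^+ N in
  forall (d : nat)
    (dO : measure_display) (Omega : measurableType dO) (P : probability Omega R)
    (F : nat -> set (set Omega))
    (dZ : measure_display) (Z : measurableType dZ)
    (z : nat -> Omega -> Z) (Pk : Z -> probability Z R) (mu : probability Z R)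
    (tau : nat)
    (C : set 'rV[R]_d) (proj : 'rV[R]_d -> 'rV[R]_d) (ths : 'rV[R]_d)
    (g : 'rV[R]_d -> Z -> 'rV[R]_d)
    (ghat : nat -> Omega -> 'rV[R]_d -> Z -> 'rV[R]_d)
    (e : nat -> Omega -> R)
    (eta : nat -> R) (theta : nat -> Omega -> 'rV[R]_d),
  (* (A1) *)
  markov_wrt P F Pk z -> stationary Pk mu ->
  (0 < tau)%N -> mixing_time Pk mu tau ->
  (* C closed convex, P_C the Euclidean projection onto C *)
  closed C -> is_convex_set C -> (forall x, is_proj C x (proj x)) ->
  (* (A2) *)
  (forall theta0 (i : 'I_d), measurable_fun setT (fun y => g theta0 y ord0 i)) ->
  (forall t, measurable_fun setT (e t)) ->
  (forall t, (\int[P]_w (e t w ^+ 2)%:E < +oo)%E) ->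
  (forall t w, enorm (g (theta t w) (z t w) - ghat t w (theta t w) (z t w))
               <= e t w) ->
  (* (A3) *)
  C ths ->
  (forall th, C th -> enorm (gbar mu g th) <= C0) ->
  (forall t w th y, C th -> enorm (ghat t w th y) <= C0) ->
  (forall th y, C th -> enorm (g th y) <= C0) ->
  (forall th, C th -> enorm th <= C1) ->
  (forall y th1 th2, C th1 -> C th2 ->
     enorm (g th1 y - g th2 y) <= G * enorm (th1 - th2)) ->
  (* is_contraction_to *)
  is_contraction_to C (gbar mu g) c ths ->
  (* step sizes *)
  c^-1 <= eta 1%N -> eta 1%N <= 2 / c ->
  (forall t, (1 <= t)%N -> eta t.+1 = expR (- (c * eta t / 2)) * eta t) ->
  (* iterates *)
  (forall w, C (theta 0%N w)) -> (forall w, C (theta 1%N w)) ->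
  (forall t w, (1 <= t)%N ->
     theta t.+1 w = proj (theta t w - eta t *: ghat t w (theta t w) (z t w))) ->
  (forall t, vmeas_wrt (F t) (theta t)) ->
  forall T : nat, (2 <= T)%N ->
  (\int[P]_w ((enorm (theta T w - ths)) ^+ 2)%:E
     <= (K * ((tau%:R) ^+ 2 * (ln (T%:R)) ^+ 3 / T%:R))%:E
        + (K / T%:R)%:E * \sum_(1 <= t < T.+1) \int[P]_w (e t w ^+ 2)%:E)%E.
Proof.
exists 7000, 5%N; split=> [|c C0 C1 G c0 C00 C10 G0 K]; first exact: ler0n.
move=> d dO Omega P F dZ Z z Pk mu tau C proj ths g ghat e eta theta.
move=> mkv stat tau0 mix _ cC projP mg me ie gghat Cths gbC0 ghatC0 gC0 CC1 gG.
move=> [_ contr] eta1_ge eta1_le etaS Cth0 Cth1 thetaS vth T T2.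
(* The update rule starts at time 1: the first two iterates lie in [C] by hypothesis, the later ones
   as projections. *)
have Cth t w : C (theta t w).
  case: t => [//|[//|t]]; rewrite thetaS//.
  by case: (projP (theta t.+1 w - eta t.+1 *: ghat t.+1 w (theta t.+1 w) (z t.+1 w))).
have dist2 x x' : C x -> C x' -> enorm (x - x') <= 2 * C1.
  move=> /CC1 h /CC1 h'; have := enormD x (- x'); rewrite enormN; lra.
pose H x y := edot (x - ths) (gbar mu g x - g x y).
(* [M] is the diameter bound [2 * C1] times the field bound [2 * C0]. In [L], the term [2 * C0] pays
   for moving the point and [2 * C1 * (2 * G)] for the change of the two fields. *)
pose M := 4 * C0 * C1; pose L := 2 * C0 + 4 * C1 * G.
have M0 : 0 < M by rewrite !mulr_gt0.
have L0 : 0 < L by rewrite addr_gt0 ?mulr_gt0.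
have gb2 x y : C x -> enorm (gbar mu g x - g x y) <= 2 * C0.
  move=> Cx; have := enormD (gbar mu g x) (- g x y); rewrite enormN.
  have := gbC0 x Cx; have := gC0 x y Cx; lra.
have HM x y : C x -> - M <= H x y <= M.
  move=> Cx; have h : enorm (x - ths) * enorm (gbar mu g x - g x y) <= M.
    have -> : M = (2 * C1) * (2 * C0) by rewrite /M; ring.
    by apply: ler_pM; rewrite ?enorm_ge0 ?dist2 ?gb2.
  rewrite (le_trans (edot_le _ _))// andbT lerNl -edotNl.
  by rewrite (le_trans (edot_le _ _))// enormN.
have HL x x' y : C x -> C x' -> H x y - H x' y <= L * enorm (x - x').
  move=> Cx Cx'.
  have -> : H x y - H x' y = edot (x - x') (gbar mu g x - g x y) +
      edot (x' - ths) ((gbar mu g x - gbar mu g x') - (g x y - g x' y)).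
    by rewrite /H !(edotBl, edotBr); ring.
  have h1 := edot_le (x - x') (gbar mu g x - g x y).
  have h2 := ler_wpM2l (enorm_ge0 (x - x')) (gb2 x y Cx).
  set w := gbar mu g x - gbar mu g x' - (g x y - g x' y).
  have h3 := edot_le (x' - ths) w.
  have h4 : enorm w <= 2 * G * enorm (x - x').
    have := enormD (gbar mu g x - gbar mu g x') (- (g x y - g x' y)); rewrite enormN -/w.
    have := gbar_lipschitz (mu := mu) mg gC0 (ltW G0) gG x x' Cx Cx'.
    have := gG y x x' Cx Cx'; lra.
  have h5 := ler_pM (enorm_ge0 _) (enorm_ge0 _) (dist2 _ _ Cx' Cths) h4.
  rewrite /L; lra.
have mH x : C x -> measurable_fun setT (H x).
  move=> Cx; rewrite /H; under eq_fun do rewrite edotBr.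
  by apply: measurable_funB => //; have [] := bmeas_edot_field mg gC0 (x - ths) x Cx.
have H0 x : C x -> \int[mu]_y H x y = 0.
  move=> Cx; rewrite /H; under eq_Rintegral do rewrite edotBr.
  rewrite RintegralB//.
  - by rewrite Rintegral_prob_cst (Rintegral_edot mg gC0)// subrr.
  - by apply: bmeas_integrable => //; exact: bmeas_cst.
  - by apply: bmeas_integrable => //; exact: (bmeas_edot_field mg gC0).
pose D t w := enorm (theta t w - ths) ^+ 2.
have bD t : bmeas (D t).
  apply: (bmeas_sqr_dist (b := 2 * C1)) => [i B mB|w]; last exact: dist2.
  by apply: (measurable_filtration mkv (t := t)); exact: vth.
have step_dist t w : (1 <= t)%N -> enorm (theta t.+1 w - theta t w) <= eta t * C0.
  move=> t1; have e0 := ltW (eta_gt0 c0 eta1_ge etaS t t1).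
  rewrite thetaS// (le_trans (proj_nonexp cC (projP _) (Cth t w)))//.
  rewrite addrAC subrr add0r enormN (enormZ _ _ e0).
  exact/ler_wpM2l/ghatC0.
pose l : R := ln T%:R.
have l2 : 2^-1 <= l by exact: lnn_ge.
(* Since [T <= 2 ^ k], a lag of [m] steps brings the distance from stationarity down to order
   [1 / T]. *)
pose k := up_log 2 T; pose m := (k * tau)%N.
(* Trivial bound while no lagged iterate with positive index exists; afterwards mixing error plus
   drift over the lag. Strictness of [m < t] matters: the step-size bounds start at time 1. *)
pose B t : R := if (t <= m)%N then M
  else 2 * M / 2 ^+ k + (2 * L * C0 * m%:R / c) / (t - m)%:R.
pose eps t := fine (\int[P]_w (e t w ^+ 2)%:E)%E.
pose r t := 2 * B t + (eps t / c + eta t * C0 ^+ 2).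
have stepD t : (1 <= t)%N -> \int[P]_w D t.+1 w <=
    expR (- (c * eta t / 2)) * \int[P]_w D t w + eta t * r t.
  move=> t1; have e0 := eta_gt0 c0 eta1_ge etaS t t1.
  have pw w : D t.+1 w <= expR (- (c * eta t / 2)) * D t w +
      eta t * (2 * H (theta t w) (z t w) + (e t w ^+ 2 / c + eta t * C0 ^+ 2)).
    have pp : is_proj C (theta t w - eta t *: ghat t w (theta t w) (z t w)) (theta t.+1 w).
      by rewrite thetaS//; exact: projP.
    exact: (projected_step cC Cths pp c0 e0 (ghatC0 _ _ _ _ (Cth t w))
      (gghat t w) (contr _ (Cth t w))).
  have [tm|mt] := leqP t m.
    apply: (expected_step (U := cst M) (h := fun w => H (theta t w) (z t w))) => //.
    - exact: bmeas_cst.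
    - by move=> w /=; have /andP[] := HM _ (z t w) (Cth t w).
    - by rewrite Rintegral_prob_cst /B tm.
  (* The quantization error can be made arbitrarily small; [del'] is scaled so that it contributes
     exactly [del]. *)
  apply/ler_addgt0Pr => del del0.
  have el0 : 0 < eta t * 2 * L by rewrite !mulr_gt0.
  have s1 : (1 <= t - m)%N by rewrite subn_gt0.
  pose del' := del / (eta t * 2 * L).
  have del'0 : 0 < del' by rewrite divr_gt0.
  have tE : (t - m + k * tau)%N = t by rewrite subnK// ltnW.
  have [U [bU HU UB]] := markov_bias_majorant mkv stat mix (vth (t - m)%N) Cths
    (Cth (t - m)%N) CC1 mH HM M0 HL (ltW L0) H0 del'0 (k := k).
  rewrite tE in HU.
  (* Each of the [m] steps after time [t - m] moves the iterate by at most
     [2 / c / (t - m) * C0]. *)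
  pose shift := L * (m%:R * (2 / c / (t - m)%:R * C0)).
  have HV w : H (theta t w) (z t w) <= U w + shift.
    have h1 := HL _ _ (z t w) (Cth t w) (Cth (t - m)%N w).
    have h2 : enorm (theta t w - theta (t - m)%N w) <= m%:R * (2 / c / (t - m)%:R * C0).
      rewrite -[in theta t w]tE; apply: (iterates_dist (x := theta ^~ w)) => u su.
      have u1 : (1 <= u)%N by exact: leq_trans su.
      rewrite (le_trans (step_dist u w u1))// ler_wpM2r ?(ltW C00)//.
      rewrite (le_trans (eta_le c0 eta1_ge eta1_le etaS u u1))//.
      rewrite ler_wpM2l ?divr_ge0 ?(ltW c0)// lef_pV2 ?posrE ?ltr0n// ler_nat.
      exact: su.
    have h3 := ler_wpM2l (ltW L0) h2.
    by have := HU w; rewrite /shift; lra.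
  have := expected_step (U := U \+ cst shift) (bD t) (bD t.+1)
    (bmeasD _ _ bU (bmeas_cst _)) (me t) (ie t) e0 c0 pw HV.
  move=> /(_ (2 * M / 2 ^+ k + L * del' + shift)).
  rewrite (plinD (plin_Rintegral P setT measurableT))//; last exact: bmeas_cst.
  rewrite Rintegral_prob_cst lerD2r => /(_ UB) /le_trans; apply.
  rewrite /r /B leqNgt mt /= -/(eps t) -[leRHS]addrA lerD2l.
  have -> : shift = 2 * L * C0 * m%:R / c / (t - m)%:R.
    by rewrite /shift; ring.
  have -> : del = eta t * (2 * (L * del')).
    rewrite /del'; field; rewrite ?gt_eqF//.
  by set u := _ / (t - m)%:R; lra.
have eps0 t : 0 <= eps t.
  by rewrite /eps fine_ge0// integral_ge0// => w _; rewrite lee_fin sqr_ge0.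
have B0 t : 0 <= B t.
  rewrite /B; case: ifP => _; first exact: ltW.
  do ?[exact: ler0n|exact: ltW|apply: addr_ge0|apply: divr_ge0|apply: mulr_ge0|apply: exprn_ge0].
have r0 t : (1 <= t)%N -> 0 <= r t.
  move=> t1; have e0 := eta_gt0 c0 eta1_ge etaS t t1.
  rewrite /r; do ?[exact: ler0n|exact: ltW|exact: B0|exact: eps0|exact: sqr_ge0|
                   apply: addr_ge0|apply: divr_ge0|apply: mulr_ge0|apply: exprn_ge0].
have T0 : 0 < T%:R :> R by rewrite ltr0n; exact: ltn_trans T2.
have rec : \int[P]_w D T w <=
    eta T * (\int[P]_w D 1%N w / eta 1%N + 4 * \sum_(1 <= t < T) r t).
  case: (T) T2 => // n _.
  exact: (contracting_recursion (D := fun t => \int[P]_w D t w) c0 eta1_ge eta1_le etaS r0 stepD n).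
have D1 : 0 <= \int[P]_w D 1%N w <= 4 * C1 ^+ 2.
  apply: Rintegral_itv => [|w]; first by case: (bD 1%N).
  rewrite /D sqr_ge0/= (_ : 4 * C1 ^+ 2 = (2 * C1) ^+ 2); last by ring.
  by rewrite lerXn2r ?nnegrE ?enorm_ge0 ?mulr_ge0 ?(ltW C10) ?dist2.
have l0 : 0 <= l by rewrite (le_trans _ l2)// invr_ge0.
have sumr : \sum_(1 <= t < T) r t = 2 * \sum_(1 <= t < T) B t +
    ((\sum_(1 <= t < T) eps t) / c + (\sum_(1 <= t < T) eta t) * C0 ^+ 2).
  by rewrite mulr_sumr !mulr_suml -!big_split.
have T1 : T = T.-1.+1 by rewrite prednK// (ltn_trans _ T2).
have T00 : (0 < T)%N by exact: ltn_trans T2.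
have sumeta : \sum_(1 <= t < T) eta t <= 2 / c * (1 + l).
  apply: (@le_trans _ _ (2 / c * \sum_(1 <= t < T) t%:R^-1)).
    rewrite mulr_sumr; apply: ler_sum_nat => t /andP[t1 _].
    exact: eta_le c0 eta1_ge eta1_le etaS t t1.
  apply: ler_wpM2l; first by rewrite divr_ge0 ?(ltW c0).
  by rewrite {1}T1; apply: harmonic_le_lnW => //; exact: leq_pred.
have sumB : \sum_(1 <= t < T) B t <=
    M * m%:R + 2 * M + 2 * L * C0 * m%:R / c * (1 + l).
  have e0 : 0 <= 2 * M / 2 ^+ k by apply: divr_ge0; rewrite ?exprn_ge0// mulr_ge0// ltW.
  rewrite T1; apply: (le_trans (sum_bias_le _ (ltW M0) e0)).
  apply: lerD; first apply: lerD => //.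
    (* There are [T - 1 <= 2 ^ k] mixing terms, so together they cost at most [2 * M]. *)
    rewrite mulrAC ler_pdivrMr ?exprn_gt0//.
    apply: ler_wpM2l; first by rewrite mulr_ge0// ltW.
    rewrite -natrX ler_nat; apply: leq_trans (leq_pred T) _; exact: up_logP.
  apply: ler_wpM2l.
    do ?[exact: ler0n|exact: ltW|apply: divr_ge0|apply: mulr_ge0].
  by apply: harmonic_le_lnW => //; apply: leq_trans (leq_subr _ _) (leq_pred T).
pose Y := \sum_(1 <= t < T) eps t.
have Y0 : 0 <= Y by apply: sumr_ge0.
have eta1_inv : (eta 1%N)^-1 <= c.
  by rewrite -[leRHS]invrK lef_pV2 ?posrE ?invr_gt0 ?(eta_gt0 c0 eta1_ge etaS).
have DT : \int[P]_w D T w <= 2 / c / T%:R * (4 * C1 ^+ 2 * c + 4 *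
    (2 * (M * m%:R + 2 * M + 2 * L * C0 * m%:R / c * (1 + l)) +
     (Y / c + 2 / c * (1 + l) * C0 ^+ 2))).
  apply: (le_trans rec); case/andP: D1 => D10 D1C.
  apply: ler_pM.
  - exact: ltW (eta_gt0 c0 eta1_ge etaS T T00).
  - rewrite addr_ge0 ?divr_ge0 ?(ltW (eta_gt0 c0 eta1_ge etaS 1 _))// mulr_ge0//.
    by rewrite big_nat; apply: sumr_ge0 => t /andP[t1 _]; exact: r0.
  - exact: eta_le c0 eta1_ge eta1_le etaS T T00.
  - apply: lerD.
      apply: ler_pM => //; rewrite invr_ge0.
      exact: ltW (eta_gt0 c0 eta1_ge etaS 1 isT).
    rewrite ler_pM2l// sumr; apply: lerD; first by rewrite ler_pM2l.
    by rewrite -/Y lerD2l ler_wpM2r ?sqr_ge0.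
have tau1 : 1 <= tau%:R :> R by rewrite ler1n.
have mle : 0 <= (m%:R : R) <= 4 * l * tau%:R.
  by rewrite ler0n /m natrM ler_wpM2r// up_log2_le_ln.
have := rate_constant_le c0 C00 C10 G0 l2 tau1 mle Y0.
rewrite -/K -/M -/L => rate.
have sum_fin : (\sum_(1 <= t < T.+1) \int[P]_w (e t w ^+ 2)%:E =
    (\sum_(1 <= t < T.+1) eps t)%:E)%E.
  rewrite -sumEFin; apply: eq_bigr => t _; rewrite /eps fineK//.
  by rewrite ge0_fin_numE// integral_ge0// => w _; rewrite lee_fin sqr_ge0.
rewrite sum_fin -(EFin_Rintegral P setT (D T))// -EFinM -EFinD lee_fin.
apply: (le_trans DT); rewrite mulrAC.
have K0 : 0 <= K.
  apply: mulr_ge0; first exact: ler0n.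
  do ?[exact: ler01|exact: ltW|apply: exprn_ge0|apply: addr_ge0].
  by rewrite invr_ge0 ltW.
have -> : K * (tau%:R ^+ 2 * ln T%:R ^+ 3 / T%:R) + K / T%:R * \sum_(1 <= t < T.+1) eps t =
    K * (tau%:R ^+ 2 * l ^+ 3 + \sum_(1 <= t < T.+1) eps t) / T%:R.
  by rewrite -/l; ring.
rewrite ler_wpM2r ?invr_ge0//; apply: (le_trans rate).
(* The recursion sums the errors up to [T - 1]; the nonnegative term at [T] is added for free. *)
by rewrite ler_wpM2l// lerD2l big_nat_recr//= lerDl.
Qed.
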